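(* For every positive integer $n$, $\text{sat}^*(n,\mathcal D_2)=n+1$. That is, every diamond-saturated family $\mathcal F\subseteq\mathcal P([n])$ has $|\mathcal F|\geq n+1$, and there exists a diamond-saturated family $\mathcal F\subseteq\mathcal P([n])$ with $|\mathcal F|=n+1$.
   Context: $[n]=\{1,\dots,n\}$ and $\mathcal P([n])$ is its power set, ordered by inclusion. The diamond $\mathcal D_2$ is the 4-element poset with a minimum, a maximum and two incomparable middle elements. A family $\mathcal F\subseteq\mathcal P([n])$ contains an induced diamond if there are four distinct sets $D,P,Q,T\in\mathcal F$ with $D\subsetneq P\subsetneq T$, $D\subsetneq Q\subsetneq T$, and $P,Q$ incomparable. $\mathcal F$ is diamond-saturated if it contains no induced diamond but for every $S\in\mathcal P([n])\setminus\mathcal F$ the family $\mathcal F\cup\{S\}$ contains an induced diamond. $\text{sat}^*(n,\mathcal D_2)$ is the minimum size of a diamond-saturated family in $\mathcal P([n])$. *)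

(* Defs.v *)
From mathcomp Require Import all_boot.

Set Implicit Arguments.
Unset Strict Implicit.
Unset Printing Implicit Defensive.

(* The ground set [n] is represented by 'I_n, so subsets of [n] have type
   {set 'I_n} and families of subsets have type {set {set 'I_n}}. *)

Definition incomparable (T : finType) (A B : {set T}) : bool :=
  ~~ (A \subset B) && ~~ (B \subset A).

Definition is_induced_diamond (T : finType) (D P Q U : {set T}) : bool :=
  [&& uniq [:: D; P; Q; U],
      D \proper P, P \proper U, D \proper Q, Q \proper U
    & incomparable P Q].

Definition has_induced_diamond (T : finType) (F : {set {set T}}) : bool :=
  [exists D in F, exists P in F, exists Q in F, exists U in F,
     is_induced_diamond D P Q U].

Definition diamond_saturated (n : nat) (F : {set {set 'I_n}}) : bool :=
  ~~ has_induced_diamond F &&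
  [forall S : {set 'I_n}, (S \notin F) ==> has_induced_diamond (S |: F)].

(* A maximal diamond-free family is saturated, so the minimum below is taken
   over a nonempty set of sizes. *)
Lemma ex_diamond_saturated_size (n : nat) :
  exists k, [exists F : {set {set 'I_n}}, diamond_saturated F && (#|F| == k)].
Proof.
have free0 : ~~ has_induced_diamond (set0 : {set {set 'I_n}}).
  by apply/existsP => -[D]; rewrite inE.
have [F /maxsetP [freeF maxF] _] :=
  @maxset_exists _ (fun F => ~~ has_induced_diamond F) _ free0.
exists #|F|; apply/existsP; exists F; rewrite eqxx andbT /diamond_saturated freeF.
apply/forallP => S; apply/implyP => SnF; apply: contraT => freeSF.
by move: SnF; rewrite -(maxF _ freeSF (subsetUr _ _)) setU11.
Qed.

Definition sat_star_diamond (n : nat) : nat := ex_minn (ex_diamond_saturated_size n).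

(* Main.v *)
Require Import Defs.
From mathcomp Require Import all_boot.
From mathcomp Require Import all_order all_algebra.

Import Order.TTheory GRing.Theory Num.Theory.

Set Implicit Arguments.
Unset Strict Implicit.
Unset Printing Implicit Defensive.

(** Lower bound: the characteristic vectors of a saturated family F affinely span
    Q^n, hence |F| >= n + 1. Let w be a weight function that is constant on F;
    we must show w = 0. A set S that is not the top of a diamond over F is
    contained in a member of F. Applied to S = Y with all points of positive
    weight added, where Y in F has the fewest points of nonpositive weight, this
    gives a member of F containing all points of positive weight. The same for
    -w and for the (also saturated) family of complements forces w to vanish on F
    and on the whole ground set. It follows in the same way that each Q in F lies
    between a member X of F avoiding the support of w and a member U containing
    it. If w <> 0, take Q in F maximal among the members not containing the
    support of w, and let S be Q with all points of positive weight added. Then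
    S is not in F and plays no role in any diamond, a contradiction.

    Upper bound: a full chain is saturated. *)

(** * Induced diamonds, saturation and complementation *)

Lemma incomparableC (T : finType) (A B : {set T}) :
  incomparable A B = incomparable B A.
Proof. exact: andbC. Qed.

Lemma incomparablexx (T : finType) (A : {set T}) : incomparable A A = false.
Proof. by rewrite /incomparable subxx. Qed.

Lemma is_induced_diamondE (T : finType) (D P Q U : {set T}) :
  is_induced_diamond D P Q U =
  [&& D \proper P, P \proper U, D \proper Q, Q \proper U & incomparable P Q].
Proof.
rewrite /is_induced_diamond; apply: andb_idl => /and5P[DP PU DQ QU PQ].
rewrite /= !inE !negb_or.
have neq (A B : {set T}) : A \proper B -> A != B by move=> AB; apply: contraTneq AB => ->; rewrite properxx.
have PneQ : P != Q by apply: contraTneq PQ => ->; rewrite incomparablexx.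
rewrite (neq D P) // (neq D Q) // (neq D U) ?(proper_trans DP PU) //.
by rewrite PneQ (neq P U) ?(neq Q U).
Qed.

Lemma has_induced_diamondP (T : finType) (F : {set {set T}}) :
  reflect (exists D P Q U, [/\ D \in F, P \in F, Q \in F, U \in F
             & is_induced_diamond D P Q U])
          (has_induced_diamond F).
Proof.
apply: (iffP exists_inP) => [[D DF /exists_inP[P PF /exists_inP[Q QF]]]|].
  by case/exists_inP=> U UF dia; exists D, P, Q, U.
case=> D [P [Q [U [DF PF QF UF dia]]]]; exists D => //.
apply/exists_inP; exists P => //; apply/exists_inP; exists Q => //.
by apply/exists_inP; exists U.
Qed.

Lemma diamond_free_comparable (T : finType) (F : {set {set T}}) (D P Q U : {set T}) :
  ~~ has_induced_diamond F -> D \in F -> P \in F -> Q \in F -> U \in F ->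
  D \proper P -> P \proper U -> D \proper Q -> Q \proper U ->
  ~~ incomparable P Q.
Proof.
move=> free DF PF QF UF DP PU DQ QU; apply: contra free => PQ.
by apply/has_induced_diamondP; exists D, P, Q, U; rewrite is_induced_diamondE DP PU DQ QU.
Qed.

(** The positions that [S] can take in a diamond whose other three sets lie in [F]. The two middle
    sets are interchangeable, so they share one constructor. *)
Variant diamond_role (T : finType) (F : {set {set T}}) (S : {set T}) : Prop :=
| DiamondBottom P Q U of P \in F & Q \in F & U \in F & S \proper P & P \proper U
    & S \proper Q & Q \proper U & incomparable P Q
| DiamondTop D P Q of D \in F & P \in F & Q \in F & D \proper P & P \proper S
    & D \proper Q & Q \proper S & incomparable P Q
| DiamondSide D Q U of D \in F & Q \in F & U \in F & D \proper S & S \proper U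
    & D \proper Q & Q \proper U & incomparable S Q.

Lemma diamond_saturated_role (n : nat) (F : {set {set 'I_n}}) (S : {set 'I_n}) :
  diamond_saturated F -> S \notin F -> diamond_role F S.
Proof.
case/andP=> free /forallP/(_ S)/implyP sat /sat /has_induced_diamondP.
case=> D [P [Q [U []]]]; rewrite !in_setU1 => DF PF QF UF /[dup] dia.
rewrite is_induced_diamondE => /and5P[DP PU DQ QU PQ].
case: (eqVneq D S) DF => [eS _|_ /= DF].
  subst D; move: PF QF UF.
  case: eqVneq DP => [->|_ SP /= PF]; first by rewrite properxx.
  case: eqVneq DQ => [->|_ SQ /= QF]; first by rewrite properxx.
  case: eqVneq PU => [->|_ PU /= UF].
    by rewrite properE => /andP[]; rewrite (proper_sub SP).
  exact: DiamondBottom PF QF UF SP PU SQ QU PQ.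
case: (eqVneq U S) UF => [eS _|_ /= UF].
  subst U; move: PF QF.
  case: eqVneq PU => [->|_ PS /= PF]; first by rewrite properxx.
  case: eqVneq QU => [->|_ QS /= QF]; first by rewrite properxx.
  exact: DiamondTop DF PF QF DP PS DQ QS PQ.
case: (eqVneq P S) PF => [eS _|_ /= PF].
  subst P; move: QF; case: eqVneq PQ => [->|_ SQ /= QF]; first by rewrite incomparablexx.
  exact: DiamondSide DF QF UF DP PU DQ QU SQ.
case: (eqVneq Q S) QF => [eS _|_ /= QF].
  by subst Q; apply: DiamondSide DF PF UF DQ QU DP PU _; rewrite incomparableC.
by case/has_induced_diamondP: free; exists D, P, Q, U.
Qed.

(** In the bottom and side positions some other set of the diamond strictly contains [S], so only
    the top position remains. *)
Lemma diamond_saturated_sub_or_top (n : nat) (F : {set {set 'I_n}}) (S : {set 'I_n}) :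
  diamond_saturated F ->
  (exists2 U, U \in F & S \subset U) \/
  (exists D P Q, [/\ D \in F, P \in F & Q \in F] /\
     [/\ D \proper P, P \proper S, D \proper Q, Q \proper S & incomparable P Q]).
Proof.
move=> sat; case: (boolP (S \in F)) => [SF|SF]; first by left; exists S.
case: (diamond_saturated_role sat SF) => [P Q U PF _ _ SP _ _ _ _||D Q U _ _ UF _ SU _ _ _].
- by left; exists P; last exact: proper_sub.
- by move=> D P Q DF PF QF DP PS DQ QS PQ; right; exists D, P, Q.
- by left; exists U; last exact: proper_sub.
Qed.

Lemma diamond_saturated_neq0 (n : nat) (F : {set {set 'I_n}}) :
  diamond_saturated F -> exists X, X \in F.
Proof.
move=> sat; case: (diamond_saturated_sub_or_top set0 sat) => [[U UF _]|]; first by exists U.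
by case=> D [P [Q [[DF _ _] _]]]; exists D.
Qed.

(** Complementation reverses inclusion and turns a diamond upside down. This duality later converts
    supersets into subsets. *)
Lemma has_induced_diamond_setC (T : finType) (F : {set {set T}}) :
  has_induced_diamond F -> has_induced_diamond [set ~: X | X in F].
Proof.
case/has_induced_diamondP=> D [P [Q [U [DF PF QF UF]]]].
rewrite is_induced_diamondE => /and5P[DP PU DQ QU PQ].
apply/has_induced_diamondP; exists (~: U), (~: P), (~: Q), (~: D).
split; try exact: imset_f.
rewrite is_induced_diamondE !properC PU DP QU DQ /=.
by rewrite incomparableC /incomparable !setCS.
Qed.

Lemma imset_setCK (T : finType) (F : {set {set T}}) :
  [set ~: X | X in [set ~: X | X in F]] = F.
Proof.
by rewrite -imset_comp -[RHS]imset_id; apply: eq_imset => X /=; rewrite setCK.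
Qed.

Lemma diamond_saturated_setC (n : nat) (F : {set {set 'I_n}}) :
  diamond_saturated F -> diamond_saturated [set ~: X | X in F].
Proof.
case/andP=> free /forallP sat; apply/andP; split.
  by apply: contra free => /has_induced_diamond_setC; rewrite imset_setCK.
apply/forallP=> S; apply/implyP=> SF.
have /(implyP (sat _)) : ~: S \notin F by apply: contra SF => /(imset_f (@setC _)); rewrite setCK.
by move/has_induced_diamond_setC; rewrite imsetU1 setCK.
Qed.

(** * Weight functions that are constant on a saturated family *)

Local Open Scope ring_scope.

Definition weight (R : realDomainType) (T : finType) (w : T -> R) (X : {set T}) : R :=
  \sum_(i in X) w i.

Lemma weight_setD (R : realDomainType) (T : finType) (w : T -> R) (X Y : {set T}) :
  X \subset Y -> weight w (Y :\: X) = weight w Y - weight w X.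
Proof.
by move=> /setIidPr XY; rewrite /weight [in RHS](big_setID X) /= XY addrC addrK.
Qed.

Lemma weight_setC (R : realDomainType) (T : finType) (w : T -> R) (X : {set T}) :
  weight w (~: X) = weight w setT - weight w X.
Proof. by rewrite -setTD weight_setD ?subsetT. Qed.

Lemma weight_opp (R : realDomainType) (T : finType) (w : T -> R) (X : {set T}) :
  weight (fun i => - w i) X = - weight w X.
Proof. by rewrite /weight sumrN. Qed.

Lemma weight_ge0_eq0 (R : realDomainType) (T : finType) (w : T -> R) (X : {set T}) :
  {in X, forall i, 0 <= w i} -> weight w X = 0 -> {in X, forall i, w i = 0}.
Proof. by move=> w0 /psumr_eq0P; apply. Qed.

Lemma weight_le0_eq0 (R : realDomainType) (T : finType) (w : T -> R) (X : {set T}) :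
  {in X, forall i, w i <= 0} -> weight w X = 0 -> {in X, forall i, w i = 0}.
Proof.
move=> w0 eq0 i iX; apply/eqP; rewrite -oppr_eq0; apply/eqP.
apply: (@weight_ge0_eq0 _ _ (fun i => - w i)) iX => [j jX|]; first by rewrite oppr_ge0 w0.
by rewrite weight_opp eq0 oppr0.
Qed.

Lemma ex_sup_pos (R : realDomainType) (n : nat) (F : {set {set 'I_n}})
    (w : 'I_n -> R) (c : R) :
  diamond_saturated F -> {in F, forall X, weight w X = c} ->
  exists2 U, U \in F & {in ~: U, forall i, w i <= 0}.
Proof.
move=> sat wF; pose Pos := [set i | 0 < w i].
have [Y0 Y0F] := diamond_saturated_neq0 sat.
case: (arg_minnP (fun X : {set 'I_n} => #|X :\: Pos|) Y0F) => Y YF minY.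
have [[U UF YU]|] := diamond_saturated_sub_or_top (Y :|: Pos) sat.
  exists U => // i; rewrite inE => iU; rewrite leNgt; apply: contra iU => wi.
  by apply: (subsetP YU); rewrite !inE wi orbT.
(* By minimality of [Y], the sets [D] and [P] have the same points outside [Pos]. So [P :\: D] is
   nonempty with positive weights only, yet its total weight is [c - c = 0]. *)
case=> D [P [Q [[DF PF _] [DP PYP _ _ _]]]].
have PPos : P :\: Pos \subset Y :\: Pos.
  apply/subsetP=> i; rewrite !inE => /andP[wi iP]; rewrite wi /=.
  by have := subsetP (proper_sub PYP) _ iP; rewrite !inE (negPf wi) orbF.
have DPos : D :\: Pos = P :\: Pos.
  have sub := setSD Pos (proper_sub DP).
  apply/eqP; rewrite eqEcard sub /=.
  exact: leq_trans (subset_leq_card PPos) (minY _ DF).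
have PDPos : {in P :\: D, forall i, 0 < w i}.
  move=> i; rewrite inE => /andP[iD iP]; apply: contraNT iD => wi.
  have : i \in P :\: Pos by rewrite !inE wi iP.
  by rewrite -DPos inE => /andP[].
have w0 : weight w (P :\: D) = 0.
  by rewrite weight_setD ?(proper_sub DP) // !wF // subrr.
case/properP: DP => _ [i iP iD]; have iPD : i \in P :\: D by rewrite inE iD.
have := weight_ge0_eq0 (fun j jPD => ltW (PDPos j jPD)) w0 iPD.
by move/eqP; rewrite gt_eqF ?PDPos.
Qed.

Lemma weight_setC_const (R : realDomainType) (T : finType) (F : {set {set T}})
    (w : T -> R) (c : R) :
  {in F, forall X, weight w X = c} ->
  {in [set ~: X | X in F], forall X, weight w X = weight w setT - c}.
Proof. by move=> wF _ /imsetP[X XF ->]; rewrite weight_setC (wF X XF). Qed.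

Lemma weight_opp_const (R : realDomainType) (T : finType) (F : {set {set T}})
    (w : T -> R) (c : R) :
  {in F, forall X, weight w X = c} ->
  {in F, forall X, weight (fun i => - w i) X = - c}.
Proof. by move=> wF X XF; rewrite weight_opp wF. Qed.

(** The complement of the [U] given by [ex_sup_pos] has weight [weight w setT - c], a sum of
    nonpositive terms. *)
Lemma const_weight_ge (R : realDomainType) (n : nat) (F : {set {set 'I_n}})
    (w : 'I_n -> R) (c : R) :
  diamond_saturated F -> {in F, forall X, weight w X = c} -> weight w setT <= c.
Proof.
move=> sat wF; have [U UF wU] := ex_sup_pos sat wF.
by rewrite -subr_le0 -(wF U UF) -weight_setC; apply: sumr_le0.
Qed.

Lemma const_weight (R : realDomainType) (n : nat) (F : {set {set 'I_n}})
    (w : 'I_n -> R) (c : R) :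
  diamond_saturated F -> {in F, forall X, weight w X = c} -> weight w setT = c.
Proof.
move=> sat wF; apply/le_anti; rewrite (const_weight_ge sat wF) /=.
by have := const_weight_ge sat (weight_opp_const wF); rewrite weight_opp lerN2.
Qed.

(** The saturated family of complements has constant weight [weight w setT - c], so the total weight
    equals both [c] and [weight w setT - c]. *)
Lemma const_weight_eq0 (R : realDomainType) (n : nat) (F : {set {set 'I_n}})
    (w : 'I_n -> R) (c : R) :
  diamond_saturated F -> {in F, forall X, weight w X = c} -> c = 0.
Proof.
move=> sat wF; have wT := const_weight sat wF.
have := const_weight (diamond_saturated_setC sat) (weight_setC_const wF).
by rewrite wT subrr.
Qed.

Lemma ex_sup_full (R : realDomainType) (n : nat) (F : {set {set 'I_n}})
    (w : 'I_n -> R) (c : R) (Q : {set 'I_n}) :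
  diamond_saturated F -> {in F, forall X, weight w X = c} -> Q \in F ->
  exists U, [/\ U \in F, Q \subset U & {in ~: U, forall i, w i = 0}].
Proof.
move=> sat wF QF; have c0 := const_weight_eq0 sat wF.
have wT := const_weight sat wF; have free : ~~ has_induced_diamond F by case/andP: sat.
(* Points of [Q] with negative weight are left out: a member of [F] inside [S] then has nonnegative
   weights of sum 0, so they all vanish and the member lies in [Q]. *)
pose S := [set i | (0 < w i) || (i \in Q) && (w i == 0)].
have [[U UF SU]|] := diamond_saturated_sub_or_top S sat.
  have wU : {in ~: U, forall i, w i = 0}.
    apply: weight_le0_eq0 => [i|]; last by rewrite weight_setC wT (wF _ UF) subrr.
    rewrite inE => iU; rewrite leNgt; apply: contra iU => wi.
    by apply: (subsetP SU); rewrite inE wi.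
  exists U; split=> //; apply/subsetP=> i iQ; apply: contraT => iU.
  have wi : w i = 0 by apply: wU; rewrite inE.
  by case/negP: iU; apply: (subsetP SU); rewrite inE iQ wi eqxx orbT.
have subQ X : X \in F -> X \subset S -> X \subset Q.
  move=> XF XS; have w0 : {in X, forall i, w i = 0}.
    apply: weight_ge0_eq0 => [i /(subsetP XS)|]; last by rewrite wF.
    by rewrite inE => /orP[/ltW //|/andP[_ /eqP->]].
  apply/subsetP=> i iX; have := subsetP XS i iX.
  by rewrite inE w0 // ltxx => /andP[].
(* A diamond over [F] with top [S] would remain a diamond with [Q] as its top. *)
case=> D [P [P' [[DF PF P'F] [DP PS DP' P'S PP']]]].
have [PQ P'Q] := (subQ P PF (proper_sub PS), subQ P' P'F (proper_sub P'S)).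
have prop (X Y : {set _}) : incomparable X Y -> X \subset Q -> Y \subset Q -> X \proper Q.
  move=> XY XQ YQ; rewrite properEneq XQ andbT.
  by apply: contraTneq XY => ->; rewrite /incomparable YQ andbF.
have P'pQ : P' \proper Q by apply: prop P'Q PQ; rewrite incomparableC.
have := diamond_free_comparable free DF PF P'F QF DP (prop _ _ PP' PQ P'Q) DP' P'pQ.
by rewrite PP'.
Qed.

(** Dual of [ex_sup_full], read off from the family of complements. *)
Lemma ex_sub_empty (R : realDomainType) (n : nat) (F : {set {set 'I_n}})
    (w : 'I_n -> R) (c : R) (Q : {set 'I_n}) :
  diamond_saturated F -> {in F, forall X, weight w X = c} -> Q \in F ->
  exists X, [/\ X \in F, X \subset Q & {in X, forall i, w i = 0}].
Proof.
move=> sat wF QF.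
have [_ [/imsetP[X XF ->]]] := ex_sup_full (diamond_saturated_setC sat)
  (weight_setC_const wF) (imset_f (@setC _) QF).
by rewrite setCS setCK => XQ w0; exists X.
Qed.

Lemma const_weight_trivial (R : realDomainType) (n : nat) (F : {set {set 'I_n}})
    (w : 'I_n -> R) (c : R) :
  diamond_saturated F -> {in F, forall X, weight w X = c} -> forall i, w i = 0.
Proof.
move=> sat wF i0; have c0 := const_weight_eq0 sat wF.
have wT := const_weight sat wF; have free : ~~ has_induced_diamond F by case/andP: sat.
apply/eqP/negPn/negP=> wi0; pose full (X : {set _}) := [forall i, (i \notin X) ==> (w i == 0)].
have fullP X : reflect {in ~: X, forall i, w i = 0} (full X).
  apply: (iffP forallP) => fX i; first by rewrite inE => /(implyP (fX i))/eqP.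
  by apply/implyP=> iX; rewrite fX ?inE.
have pos_full X : X \in F -> [set i | 0 < w i] \subset X -> full X.
  move=> XF posX; apply/fullP.
  apply: weight_le0_eq0 => [i|]; last by rewrite weight_setC wT (wF _ XF) subrr.
  rewrite inE => iX; rewrite leNgt; apply: contra iX => wi.
  by apply: (subsetP posX); rewrite inE.
have [X0 X0F] := diamond_saturated_neq0 sat.
have [X1 [X1F _ X1w]] := ex_sub_empty sat wF X0F.
(* [X1] avoids the support of [w], which contains [i0], so the maximum defining [Q] is over a
   nonempty set. *)
have X1P : (X1 \in F) && ~~ full X1.
  rewrite X1F; apply: contra wi0 => /fullP fX1.
  by case: (boolP (i0 \in X1)) => iX1; [rewrite X1w | rewrite fX1 ?inE].
case: (@arg_maxnP _ X1 (fun X => (X \in F) && ~~ full X) (fun X => #|X|) X1P)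
  => Q /andP[QF Qfull] maxQ.
have {}maxQ X : X \in F -> Q \proper X -> full X.
  move=> XF QX; apply: contraTT (proper_card QX) => fX.
  by rewrite -leqNgt; apply: maxQ; rewrite XF.
pose S := Q :|: [set i | 0 < w i].
have QS : Q \subset S by exact: subsetUl.
(* If [S] were in [F], then [S :\: Q] would have weight 0 and positive points only, so [Q] would
   already contain all positive points and be full. *)
have SF : S \notin F.
  apply: contra Qfull => SF; apply: pos_full => //; apply/subsetP=> i.
  rewrite inE => wi; apply: contraLR wi => iQ.
  have w0 : weight w (S :\: Q) = 0 by rewrite weight_setD // !wF // subrr.
  have S_ge0 : {in S :\: Q, forall j, 0 <= w j}.
    by move=> j; rewrite !inE => /andP[/negPf->] /ltW.
  apply/negP=> wi; have := weight_ge0_eq0 S_ge0 w0 (x := i).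
  by rewrite !inE iQ wi orbT => /(_ isT) eq0; rewrite eq0 ltxx in wi.
have full_sup X : X \in F -> full X -> Q \subset X -> S \subset X.
  move=> XF /fullP fX QX; rewrite subUset QX; apply/subsetP=> i.
  by rewrite inE; apply: contraTT => iX; rewrite fX ?inE // ltxx.
case: (diamond_saturated_role sat SF).
(* [S] as bottom: [Q] can replace it. *)
- move=> P P' U PF P'F UF SP PU SP' P'U PP'.
  have := diamond_free_comparable free QF PF P'F UF
    (sub_proper_trans QS SP) PU (sub_proper_trans QS SP') P'U.
  by rewrite PP'.
(* [S] as top: a full member of [F] above [Q] contains [S] and can replace it. *)
- move=> D P P' DF PF P'F DP PS DP' P'S PP'.
  have [U [UF QU /fullP fU]] := ex_sup_full sat wF QF.
  have SU := full_sup U UF fU QU.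
  have := diamond_free_comparable free DF PF P'F UF
    DP (proper_sub_trans PS SU) DP' (proper_sub_trans P'S SU).
  by rewrite PP'.
(* [S] as side: [Q] replaces [S], and a member [X] inside [D] that avoids the support replaces [D],
   since [D] need not lie in [Q]. *)
move=> D Q' U DF Q'F UF DS SU DQ' Q'U SQ'.
have [X [XF XD Xw]] := ex_sub_empty sat wF DF.
have XQ : X \subset Q.
  apply/subsetP=> i iX; have := subsetP (subset_trans XD (proper_sub DS)) i iX.
  by rewrite !inE Xw // ltxx orbF.
(* Otherwise [Q'] would strictly contain [Q], hence be full by maximality and contain [S]. *)
have Q_Q' : ~~ (Q \subset Q').
  case/andP: SQ' => SQ' Q'S; apply: contra SQ' => QQ'.
  apply: full_sup => //; apply: maxQ => //; rewrite properEneq QQ' andbT.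
  by apply: contraNneq Q'S => <-.
have XQp : X \proper Q.
  rewrite properEneq XQ andbT; apply: contraNneq Q_Q' => <-.
  exact: subset_trans XD (proper_sub DQ').
have := diamond_free_comparable free XF QF Q'F UF XQp
  (sub_proper_trans QS SU) (sub_proper_trans XD DQ') Q'U.
rewrite /incomparable negb_and !negbK (negPf Q_Q') /= => Q'Q.
by case/andP: SQ' => _ /negP[]; exact: subset_trans QS.
Qed.

(* If |F| <= n, the n + 1 unknowns w and c of the system "weight w X = c for
   all X in F" admit a nonzero solution. *)
Lemma diamond_saturated_card (n : nat) (F : {set {set 'I_n}}) :
  diamond_saturated F -> (n < #|F|)%N.
Proof.
move=> sat; rewrite ltnNge; apply/negP=> cardF.
pose B : 'M[rat]_(n, #|F|) := \matrix_(i, j) (i \in (enum_val j : {set 'I_n}))%:R.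
(* The row of ones carries the constant: a row vector killed by [A] has first entry [- c], followed
   by the values of [w]. *)
pose A := col_mx (const_mx 1 : 'rV[rat]_#|F|) B.
have : kermx A != 0.
  rewrite -mxrank_eq0 mxrank_ker -lt0n subn_gt0.
  exact: leq_trans (rank_leq_col A) cardF.
rewrite -nz_row_eq0; set u := nz_row _ => u0.
have : u *m A = 0 by apply/sub_kermxP; exact: nz_row_sub.
rewrite -(hsubmxK u) mul_row_col => uA; pose w i := rsubmx u 0 i.
have wF : {in F, forall X, weight w X = - lsubmx u 0 0}.
  move=> X XF; have := congr1 (fun M : 'rV_#|F| => M 0 (enum_rank_in XF X)) uA.
  rewrite !mxE big_ord1 !mxE mulr1 => /eqP; rewrite addrC addr_eq0 => /eqP <-.
  rewrite /weight big_mkcond; apply: eq_bigr => i _.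
  by rewrite /w !mxE enum_rankK_in //; case: ifP => _; rewrite ?mulr1 ?mulr0.
case/eqP: u0; rewrite -(hsubmxK u); apply/eqP; rewrite row_mx_eq0; apply/andP; split.
  apply/eqP/rowP=> i; rewrite ord1 [RHS]mxE; apply: oppr_inj.
  by rewrite oppr0 (const_weight_eq0 sat wF).
by apply/eqP/rowP=> i; rewrite [RHS]mxE; apply: const_weight_trivial sat wF i.
Qed.

Local Close Scope ring_scope.

(** * A saturated family of size [n.+1]: the full chain of initial segments *)

Definition initial_segment (n k : nat) : {set 'I_n} := [set i : 'I_n | i < k].

Definition initial_chain (n : nat) : {set {set 'I_n}} :=
  [set initial_segment n k | k : 'I_n.+1].

Lemma card_initial_segment (n k : nat) : k <= n -> #|initial_segment n k| = k.
Proof.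
move=> kn; rewrite cardsE -sum1_card -(big_ord_widen _ (fun=> 1)) //.
by rewrite sum_nat_const card_ord muln1.
Qed.

Lemma initial_segmentS (n j k : nat) :
  j <= k -> initial_segment n j \subset initial_segment n k.
Proof. by move=> jk; apply/subsetP=> i; rewrite !inE => /leq_trans->. Qed.

Lemma initial_segment_in_chain (n k : nat) :
  k <= n -> initial_segment n k \in initial_chain n.
Proof. by move=> kn; apply/imsetP; exists (inord k); rewrite // inordK. Qed.

Lemma card_initial_chain (n : nat) : #|initial_chain n| = n.+1.
Proof.
rewrite card_imset ?card_ord // => j k /(congr1 (fun X : {set _} => #|X|)).
by rewrite !card_initial_segment ?leq_ord //; exact: val_inj.
Qed.

(** Members of a chain are pairwise comparable. A set outside it is incomparable to the segment of
    its own size, and [set0] and [setT] complete these two to a diamond. *)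
Lemma initial_chain_saturated (n : nat) : diamond_saturated (initial_chain n).
Proof.
apply/andP; split.
  apply/negP=> /has_induced_diamondP[D [P [Q [U [_ PF QF _]]]]].
  rewrite is_induced_diamondE => /and5P[_ _ _ _].
  case/imsetP: PF QF => j _ -> /imsetP[k _ ->]; rewrite /incomparable.
  case/andP=> /negP jk /negP kj.
  by case: (leqP j k) => [/(initial_segmentS n)/jk|/ltnW/(initial_segmentS n)/kj].
apply/forallP=> S; apply/implyP=> SC; set k := #|S|.
have kn : k <= n by rewrite -[n in _ <= n]card_ord max_card.
have card_k : #|initial_segment n k| = k by exact: card_initial_segment.
have neqS : initial_segment n k != S.
  by apply: contraNneq SC => <-; exact: initial_segment_in_chain.
have inc : incomparable S (initial_segment n k).
  rewrite /incomparable; apply/andP; split.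
    by apply: contra neqS => sub; rewrite eq_sym eqEcard sub card_k /=.
  by apply: contra neqS => sub; rewrite eqEcard sub card_k /=.
have [seg0 segn] : initial_segment n 0 = set0 /\ initial_segment n n = setT.
  by split; apply/setP=> i; rewrite !inE // ltn_ord.
have chain0 : set0 \in initial_chain n by rewrite -seg0 initial_segment_in_chain.
have chainT : setT \in initial_chain n by rewrite -segn initial_segment_in_chain.
apply/has_induced_diamondP.
exists set0, S, (initial_segment n k), setT; split; rewrite ?inE ?eqxx ?chain0 ?chainT ?orbT //.
  by rewrite initial_segment_in_chain ?orbT.
rewrite is_induced_diamondE inc andbT !proper0 !properT.
(* Incomparability excludes [set0] and [setT], which yields all four strict inclusions. *)
have prop A B : incomparable A B -> (A != set0 :> {set 'I_n}) && (A != setT).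
  by move=> AB; apply/andP; split; apply: contraTneq AB => ->;
     rewrite /incomparable ?sub0set ?subsetT ?andbF.
have /andP[-> ->] := prop _ _ inc.
by rewrite incomparableC in inc; have /andP[-> ->] := prop _ _ inc.
Qed.

Theorem theorem1p2 (n : nat) (hn : 0 < n) :
  sat_star_diamond n = n.+1 /\
  (forall F : {set {set 'I_n}}, diamond_saturated F -> n.+1 <= #|F|) /\
  (exists F : {set {set 'I_n}}, diamond_saturated F /\ #|F| = n.+1).
Proof.
have chain := initial_chain_saturated n; have cardC := card_initial_chain n.
split; last first.
  by split; [exact: diamond_saturated_card | exists (initial_chain n)].
rewrite /sat_star_diamond; case: ex_minnP => m /existsP[F /andP[sat /eqP <-]] minF.
apply/eqP; rewrite eqn_leq diamond_saturated_card // andbT.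
by apply: minF; apply/existsP; exists (initial_chain n); rewrite chain cardC /=.
Qed.
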